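(* Let $p \neq 2$ be a prime and let $g \in \mathbb{Z}_p^\times$ be fixed. Let $m$ be the multiplicative order of $g$ modulo $p$, and let $d = \frac{\gcd(k,p-1)}{\gcd\left(k,\frac{p-1}{m}\right)}$ have prime factorization $q_1^{\alpha_1}\cdots q_i^{\alpha_i}$, and $$N = \frac{m\cdot\gcd(k,p-1)}{q_1^{\lceil \alpha_1/n\rceil}\cdots q_i^{\lceil \alpha_i/n\rceil}},$$ where $k = p$ and $n = 1$. Then there are exactly $N$ solutions $x \in \{1,2,\ldots,mp\}$ to $$g^{x} \equiv x^p \pmod{p}.$$ Furthermore, for every integer $e>1$, the congruence $$g^{x} \equiv x^p \pmod{p^e}$$ has exactly $Np$ solutions $x \in \{1,2,\ldots,mp^e\}$ if $g^{p-1} \equiv 1 \pmod{p^2}$ (i.e. $g$ is a Wieferich base modulo $p$), and no solutions otherwise.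
   Context: $\mathbb{Z}_p$ denotes the ring of $p$-adic integers and $\mathbb{Z}_p^\times$ its unit group. For $g \in \mathbb{Z}_p^\times$, the multiplicative order of $g$ modulo $p$ is the order of the image of $g$ in $(\mathbb{Z}/p\mathbb{Z})^\times$. Congruences modulo $p^e$ between elements of $\mathbb{Z}_p$ mean that the difference lies in $p^e\mathbb{Z}_p$. Solutions $x$ are integers. The prime factorization of $d$ has distinct primes $q_j$ and exponents $\alpha_j\ge 1$; an empty product equals $1$. $g$ is called a Wieferich base modulo $p$ if $g^{p-1} \equiv 1 \pmod{p^2}$. *)

(* Defs.v *)
From HB Require Import structures.
From mathcomp Require Import all_boot all_order all_fingroup all_algebra.
From mathcomp Require Import boolp.

Set Implicit Arguments.
Unset Strict Implicit.
Unset Printing Implicit Defensive.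

Import GRing.Theory.
Local Open Scope ring_scope.

Section Reduction.
Variables M N : nat.
Hypotheses (M_gt1 : (1 < M)%N) (N_gt1 : (1 < N)%N) (dvdMN : (M %| N)%N).

(* The canonical map Z/N -> Z/M; it is a ring morphism when M divides N. *)
Definition zred (a : 'Z_N) : 'Z_M := (a : nat)%:R.

Lemma zred_nat k : zred k%:R = k%:R.
Proof.
rewrite /zred val_Zp_nat //; apply/val_inj.
by rewrite /= !val_Zp_nat // modn_dvdm.
Qed.

Lemma zred0 : zred 0 = 0. Proof. exact: (zred_nat 0). Qed.
Lemma zred1 : zred 1 = 1. Proof. exact: (zred_nat 1). Qed.

Lemma zredD a b : zred (a + b) = zred a + zred b.
Proof.
by rewrite -[a]natr_Zp -[b]natr_Zp -natrD !zred_nat natrD.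
Qed.

Lemma zredM a b : zred (a * b) = zred a * zred b.
Proof.
by rewrite -[a]natr_Zp -[b]natr_Zp -natrM !zred_nat natrM.
Qed.

Lemma zredN a : zred (- a) = - zred a.
Proof. by apply/eqP; rewrite -addr_eq0 -zredD addNr zred0. Qed.

Lemma zred_unit a : a \is a GRing.unit -> zred a \is a GRing.unit.
Proof.
by move=> Ua; apply/unitrPr; exists (zred a^-1); rewrite -zredM divrr ?zred1.
Qed.

Lemma zredV a : a \is a GRing.unit -> zred a^-1 = (zred a)^-1.
Proof.
move=> Ua; apply: (mulIr (zred_unit Ua)).
by rewrite -zredM !mulVr ?zred_unit ?zred1.
Qed.

End Reduction.

(* The inverse limit of the rings Z/p^(n+1), n >= 0.  The exponent is shifted
   because 'Z_1 is Z/2 rather than the zero ring; omitting Z/p^0 does not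
   change the limit. *)
Record padic (p : nat) (p_pr : prime p) := Padic {
  approx :> forall n, 'Z_(p ^ n.+1);
  padic_coh : forall n, zred (p ^ n.+1) (approx n.+1) = approx n
}.

Section PadicRing.
Variables (p : nat) (p_pr : prime p).
Local Notation Zp := (padic p_pr).

HB.instance Definition _ := gen_eqMixin Zp.
HB.instance Definition _ := gen_choiceMixin Zp.

Lemma padicP (a b : Zp) : (forall n, a n = b n) -> a = b.
Proof.
case: a b => [a ca] [b cb] /= eq_ab.
have E : a = b by apply: functional_extensionality_dep.
by case: _ / E cb => cb; congr Padic; apply: Prop_irrelevance.
Qed.

Lemma ppow_gt1 n : (1 < p ^ n.+1)%N.
Proof. by rewrite -(exp1n n.+1) ltn_exp2r // prime_gt1. Qed.

Lemma ppow_dvd n : (p ^ n.+1 %| p ^ n.+2)%N.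
Proof. exact: dvdn_exp2l. Qed.

Fact padic_nat_coh k n :
  zred (p ^ n.+1) (k%:R : 'Z_(p ^ n.+2)) = k%:R.
Proof. by rewrite zred_nat ?ppow_gt1 ?ppow_dvd. Qed.
Definition padic_nat k : Zp := Padic p_pr (padic_nat_coh k).

Fact padic_add_coh (a b : Zp) n :
  zred (p ^ n.+1) (a n.+1 + b n.+1) = a n + b n.
Proof. by rewrite zredD ?ppow_gt1 ?ppow_dvd // !padic_coh. Qed.
Definition padic_add a b : Zp := Padic p_pr (padic_add_coh a b).

Fact padic_opp_coh (a : Zp) n : zred (p ^ n.+1) (- a n.+1) = - a n.
Proof. by rewrite zredN ?ppow_gt1 ?ppow_dvd // padic_coh. Qed.
Definition padic_opp a : Zp := Padic p_pr (padic_opp_coh a).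

Fact padic_mul_coh (a b : Zp) n :
  zred (p ^ n.+1) (a n.+1 * b n.+1) = a n * b n.
Proof. by rewrite zredM ?ppow_gt1 ?ppow_dvd // !padic_coh. Qed.
Definition padic_mul a b : Zp := Padic p_pr (padic_mul_coh a b).

Fact padic_addA : associative padic_add.
Proof. by move=> a b c; apply: padicP => n /=; rewrite addrA. Qed.
Fact padic_addC : commutative padic_add.
Proof. by move=> a b; apply: padicP => n /=; rewrite addrC. Qed.
Fact padic_add0 : left_id (padic_nat 0) padic_add.
Proof. by move=> a; apply: padicP => n /=; rewrite add0r. Qed.
Fact padic_addN : left_inverse (padic_nat 0) padic_opp padic_add.
Proof. by move=> a; apply: padicP => n /=; rewrite addNr. Qed.

HB.instance Definition _ :=
  GRing.isZmodule.Build Zp padic_addA padic_addC padic_add0 padic_addN.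

Fact padic_mulA : associative padic_mul.
Proof. by move=> a b c; apply: padicP => n /=; rewrite mulrA. Qed.
Fact padic_mulC : commutative padic_mul.
Proof. by move=> a b; apply: padicP => n /=; rewrite mulrC. Qed.
Fact padic_mul1 : left_id (padic_nat 1) padic_mul.
Proof. by move=> a; apply: padicP => n /=; rewrite mul1r. Qed.
Fact padic_mulDl : left_distributive padic_mul +%R.
Proof. by move=> a b c; apply: padicP => n /=; rewrite mulrDl. Qed.
Fact padic_1neq0 : padic_nat 1 != 0 :> Zp.
Proof.
apply/eqP => /(congr1 (fun a : Zp => a 0)) /= /eqP.
by rewrite oner_eq0.
Qed.

HB.instance Definition _ := GRing.Zmodule_isComNzRing.Build Zp
  padic_mulA padic_mulC padic_mul1 padic_mulDl padic_1neq0.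

(* The canonical map Z_p -> Z/p; ['Z_(p ^ 1)] is convertible to ['Z_p]. *)
Definition residue (a : Zp) : 'Z_p := a 0.

Fact residue_is_zmod_morphism : zmod_morphism residue.
Proof. by []. Qed.
Fact residue_is_monoid_morphism : monoid_morphism residue.
Proof. by []. Qed.
HB.instance Definition _ :=
  GRing.isZmodMorphism.Build Zp 'Z_p residue residue_is_zmod_morphism.
HB.instance Definition _ :=
  GRing.isMonoidMorphism.Build Zp 'Z_p residue residue_is_monoid_morphism.

(* The instance below proves that these are exactly the invertible elements. *)
Definition padic_unit : {pred Zp} := fun a => residue a \is a GRing.unit.

Lemma padic_unit_approx (a : Zp) n :
  padic_unit a -> a n \is a GRing.unit.
Proof.
move=> Ua; have key (k : nat) i :
    ((k%:R : 'Z_(p ^ i.+1)) \is a GRing.unit) = coprime p k.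
  by rewrite unitZpE ?ppow_gt1 // coprime_pexpl.
elim: n => [|n IHn]; first exact: Ua.
by move: IHn; rewrite -(padic_coh a n) -[a n.+1]natr_Zp zred_nat
  ?ppow_gt1 ?ppow_dvd // !key.
Qed.

Fact padic_inv_coh (a : Zp) n :
  zred (p ^ n.+1) (if padic_unit a then (a n.+1)^-1 else a n.+1) =
  if padic_unit a then (a n)^-1 else a n.
Proof.
case: ifP => Ua; last exact: padic_coh.
by rewrite zredV ?ppow_gt1 ?ppow_dvd ?padic_unit_approx // padic_coh.
Qed.
Definition padic_inv (a : Zp) : Zp := Padic p_pr (padic_inv_coh a).

Fact padic_mulVr : {in padic_unit, left_inverse 1 padic_inv *%R}.
Proof.
move=> a Ua; apply: padicP => n /=; rewrite [padic_unit a]Ua mulVr //.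
exact: padic_unit_approx.
Qed.
Fact padic_unitP (a b : Zp) : b * a = 1 -> padic_unit a.
Proof.
move=> ba1; apply/unitrPr; exists (residue b).
by rewrite -rmorphM mulrC ba1 rmorph1.
Qed.
Fact padic_inv_out : {in [predC padic_unit], padic_inv =1 id}.
Proof.
by move=> a /negbTE Ua; apply: padicP => n /=; rewrite [padic_unit a]Ua.
Qed.

HB.instance Definition _ := GRing.ComNzRing_hasMulInverse.Build Zp
  padic_mulVr padic_unitP padic_inv_out.

(* The multiplicative order of g modulo p: the order, in the finite group
   (Z/p)^*, of the image of g. *)
Definition order_modp (g : Zp) (g_unit : g \is a GRing.unit) : nat :=
  #[FinRing.unit 'Z_p (rmorph_unit residue g_unit)]%g.

Definition padic_eqmod (e : nat) (a b : Zp) : Prop :=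
  exists c : Zp, a - b = p%:R ^+ e * c.

Definition Wieferich_base (g : Zp) : Prop := padic_eqmod 2 (g ^+ p.-1) 1.

(* The number of x in {1, ..., B} with g^x = x^k modulo p^e. *)
Definition nb_solutions (g : Zp) (k e B : nat) : nat :=
  count (fun x : nat => `[< padic_eqmod e (g ^+ x) (x%:R ^+ k) >]) (iota 1 B).

End PadicRing.

(* The ceiling of a / n, for n > 0. *)
Definition ceil_div (a n : nat) : nat := (a + n.-1) %/ n.

Lemma ceil_divP (a n c : nat) :
  (0 < n)%N -> (ceil_div a n <= c)%N = (a <= c * n)%N.
Proof.
case: n => // n _; rewrite /ceil_div -ltnS ltn_divLR //= mulSn.
by rewrite addnC addSn ltnS leq_add2l.
Qed.

(* Main.v *)
Require Import Defs.
From mathcomp Require Import all_boot all_order all_fingroup all_algebra.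
From mathcomp Require Import boolp.
From mathcomp Require Import cyclic zify ring.

(** Since p is coprime to p - 1, here d = 1 and N = m.  Replacing g by an integer
    G congruent to it modulo p^e makes the statement one about G^x = x^p.
    Modulo p the equation reads G^x = x, which has exactly one solution modulo
    mp in each class modulo m.  A solution modulo p^2 is prime to p, and
    A = G^(p-1) then satisfies A^x = A^p = 1 modulo p^2, whence A = 1: the base
    is Wieferich.  Conversely, if it is, then G^(m p^j) = 1 modulo p^(j+2), so
    modulo p^(f+2) both sides depend only on x modulo m p^(f+1); modulo p^2 the
    equation is equivalent to the one modulo p, and a class modulo m p^(f+1) of
    solutions modulo p^(f+2) contains exactly one class modulo m p^(f+2) of
    solutions modulo p^(f+3), because the congruence for the next digit is
    linear with invertible slope. *)

(** * Counting over full sets of residues *)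

Lemma count_iota_periodic (P : pred nat) B :
  (forall x, P (x + B) = P x) -> count P (iota 1 B) = \sum_(x < B) P x.
Proof.
move=> perP; rewrite -(big_mkord xpredT (fun x => P x : nat)).
rewrite -(big_map P xpredT (fun b : bool => b : nat)) -sum1_count.
rewrite /index_iota subn0 big_map big_mkcond /=.
have -> : \sum_(i <- iota 1 B) (if P i then 1 else 0) =
    \sum_(i <- iota 1 B) P i.
  by apply: eq_bigr => i _; case: (P i).
(* With [P 0] added, the left sum runs over 0, ..., B, and its last term [P B] equals [P 0]. *)
apply/(@addnI (P 0)).
rewrite -(big_cons _ addn 0 (iota 1 B) xpredT (fun x => P x : nat)).
rewrite -[0 :: iota 1 B]/(iota 0 B.+1) -addn1 iotaD big_cat big_seq1 /=.
by rewrite addnC -(perP 0).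
Qed.

Lemma sum_ord_mul (F : nat -> nat) B c :
  \sum_(x < B * c) F x = \sum_(x < B) \sum_(t < c) F (x + B * t).
Proof.
rewrite exchange_big /=; elim: c => [|c IHc]; first by rewrite muln0 !big_ord0.
rewrite big_ord_recr -IHc mulnSr big_split_ord /=.
by congr addn; apply: eq_bigr => i _; rewrite addnC.
Qed.

(** Unique lifting as a count: of the [c] classes modulo [B * c] above a class modulo [B], exactly
    one satisfies [Q] if [P] holds below, and none otherwise. *)
Lemma count_lift (P Q : pred nat) B c :
    (forall x t, Q (x + B * t) -> P x) ->
    (forall x, P x -> \sum_(t < c) Q (x + B * t) = 1) ->
  \sum_(x < B * c) Q x = \sum_(x < B) P x.
Proof.
move=> QP liftQ; rewrite (sum_ord_mul (fun x => Q x)).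
apply: eq_bigr => x _; have [/liftQ->|nPx] := boolP (P x); first by [].
by rewrite big1 // => t _; case: (boolP (Q _)) => // /QP; rewrite (negPf nPx).
Qed.

(** * Congruences between natural numbers and their p-th powers *)

Lemma eqn_mod_dvdm d n a b : d %| n -> a = b %[mod n] -> a = b %[mod d].
Proof. by move=> dn E; rewrite -(modn_dvdm a dn) E modn_dvdm. Qed.

Lemma eqn_mod_exp a b n k : a = b %[mod n] -> a ^ k = b ^ k %[mod n].
Proof. by move=> E; rewrite -modnXm E modnXm. Qed.

Lemma eqn_mod_cancel a b c n :
  coprime n a -> a * b = a * c %[mod n] -> b = c %[mod n].
Proof.
move=> cna; wlog le_cb : b c / c <= b => [hw|].
  by case/orP: (leq_total c b) => [/hw|/hw H E]; last by rewrite H.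
move/eqP; rewrite eqn_mod_dvd ?leq_mul2l ?le_cb ?orbT // -mulnBr Gauss_dvdr //.
by rewrite -eqn_mod_dvd // => /eqP.
Qed.

(** As K is invertible modulo p, t -> a + K t permutes the residues. *)
Lemma linear_congr_uniq p a b K : prime p -> coprime p K ->
  \sum_(t < p) (a + K * t == b %[mod p]) = 1.
Proof.
move=> p_pr cpK; have p_gt0 := prime_gt0 p_pr.
pose f (t : 'I_p) := Ordinal (ltn_pmod (a + K * t) p_gt0).
have f_inj : injective f.
  move=> s t /(congr1 val)/= /eqP; rewrite eqn_modDl => /eqP.
  by move/(eqn_mod_cancel _ _ _ _ cpK); rewrite !modn_small // => /val_inj.
have [h fK hK] := injF_bij f_inj.
rewrite -big_mkcond /= (big_pred1 (h (Ordinal (ltn_pmod b p_gt0)))) // => t.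
by rewrite /= -(inj_eq f_inj) hK -val_eqE.
Qed.

(* The terms of index i >= j vanish: for i < p the binomial coefficient supplies
   the extra factor p, and for i = p > j the power of y does. *)
Lemma expnD_mod_prime p f a y j : prime p -> p ^ f.+1 %| y -> 0 < j < p ->
  (a + y) ^ p = \sum_(i < j) 'C(p, i) * (a ^ (p - i) * y ^ i)
    %[mod p ^ (f.+1 * j).+1].
Proof.
move=> p_pr p_y /andP[j_gt0 lt_jp]; have p_gt0 := prime_gt0 p_pr.
rewrite expnDn -(big_mkord xpredT (fun i => 'C(p, i) * (a ^ (p - i) * y ^ i))).
rewrite (big_cat_nat (leq0n j)) /=; last by lia.
rewrite big_mkord -modnDmr; set tail := \sum_(j <= i < _) _.
suff /eqP-> : p ^ (f.+1 * j).+1 %| tail by rewrite addn0.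
rewrite /tail big_nat_cond; apply: dvdn_sum => i /andP[/andP[le_ji le_ip] _].
have p_yi : p ^ (f.+1 * i) %| y ^ i by rewrite expnM dvdn_exp2r.
move: le_ip; rewrite ltnS leq_eqVlt => /predU1P[ip|lt_ip].
  rewrite dvdn_mull // dvdn_mull // (dvdn_trans _ p_yi) // dvdn_exp2l //.
  by rewrite ip; nia.
rewrite expnS dvdn_mul ?prime_dvd_bin ?lt_ip ?(leq_trans j_gt0) //.
rewrite dvdn_mull // (dvdn_trans _ p_yi) // dvdn_exp2l //.
by rewrite leq_mul2l le_ji orbT.
Qed.

(** The case [j = 1] of the truncated binomial expansion, where only b^p survives. *)
Lemma eqn_mod_exp_prime p f a b : prime p ->
  a = b %[mod p ^ f.+1] -> a ^ p = b ^ p %[mod p ^ f.+2].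
Proof.
move=> p_pr; wlog le_ba : a b / b <= a => [hw|].
  by case/orP: (leq_total b a) => [/hw|/hw H E]; last by rewrite H.
move/eqP; rewrite eqn_mod_dvd // => p_ab.
have -> : f.+2 = (f.+1 * 1).+1 by rewrite muln1.
rewrite -(subnKC le_ba).
rewrite (expnD_mod_prime _ _ _ _ 1 p_pr p_ab) ?prime_gt1 //.
by rewrite big_ord1 bin0 mul1n subn0 expn0 muln1.
Qed.

(** * The congruence G^x = x^p for an integer base G *)

Section Congruence.
Variables (p : nat) (p_pr : prime p) (p_neq2 : p <> 2) (G m : nat).
Hypotheses (cpG : coprime p G) (cpm : coprime p m) (Gm1 : G ^ m = 1 %[mod p]).

Let sol e x := G ^ x == x ^ p %[mod p ^ e].

(** Modulo p, x = x^p = G^x is a power of a unit. *)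
Lemma sol_coprime e x : 0 < e -> sol e x -> coprime p x.
Proof.
move=> e_gt0 /eqP/(eqn_mod_dvdm p _ _ _ (dvdn_exp e_gt0 (dvdnn p))).
rewrite fermat_little // => E.
by rewrite -coprime_modr -E coprime_modr coprimeXr.
Qed.

Lemma expn_pred_mod1 : G ^ p.-1 = 1 %[mod p].
Proof.
apply: (eqn_mod_cancel _ _ _ _ cpG).
by rewrite -expnS prednK ?prime_gt0 // muln1 fermat_little.
Qed.

Lemma expnD_order_modp x t : G ^ (x + m * t) = G ^ x %[mod p].
Proof.
rewrite expnD expnM -modnMmr (eqn_mod_exp _ 1 _ t Gm1) exp1n modnMmr.
by rewrite muln1.
Qed.

Lemma sol_modp_periodic x : sol 1 (x + m * p) = sol 1 x.
Proof.
rewrite /sol expn1; congr (_ == _); first exact: expnD_order_modp.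
by rewrite !fermat_little // addnC modnMDl.
Qed.

(** Modulo p, G^(x + m t) does not depend on t, while x + m t takes every residue once. *)
Lemma sum_sol_modp : \sum_(x < m * p) sol 1 x = m.
Proof.
rewrite (count_lift xpredT) // => [|x _]; first by rewrite sum1_card card_ord.
rewrite -[RHS](linear_congr_uniq p x (G ^ x) m p_pr cpm).
apply: eq_bigr => t _; congr (nat_of_bool _).
rewrite /sol expn1 [LHS]eq_sym fermat_little //; congr (_ == _).
exact: expnD_order_modp.
Qed.

Lemma sol_p2_Wieferich x : sol 2 x -> G ^ p.-1 = 1 %[mod p ^ 2].
Proof.
move=> sx; have cpx := sol_coprime 2 x isT sx; move/eqP: sx => Gx.
have p_gt0 := prime_gt0 p_pr.
set A := G ^ p.-1.
have Ax1 : A ^ x = 1 %[mod p ^ 2].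
  have cG : coprime (p ^ 2) (G ^ x) by rewrite coprimeXl // coprimeXr.
  apply: (eqn_mod_cancel _ _ _ _ cG).
  (* Raising G^x = x modulo p to the p-th power gives (G^x)^p = x^p = G^x modulo p^2. *)
  have -> : G ^ x * A ^ x = (G ^ x) ^ p.
    by rewrite -expnMn -expnS prednK // -!expnM mulnC.
  rewrite muln1 Gx; apply: (eqn_mod_exp_prime _ 0 _ _ p_pr).
  rewrite -[RHS](fermat_little x p_pr) expn1.
  by apply: (eqn_mod_dvdm _ _ _ _ _ Gx); rewrite dvdn_exp.
have Ap1 : A ^ p = 1 %[mod p ^ 2].
  rewrite (eqn_mod_exp_prime _ 0 _ 1 p_pr) ?exp1n //.
  by rewrite expn1 expn_pred_mod1.
have x_gt0 : 0 < x.
  rewrite lt0n; apply: contraTneq cpx => ->.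
  by rewrite /coprime gcdn0 gtn_eqF ?prime_gt1.
(* Bezout: u x = v p + 1, so 1 = A^(u x) = A^(v p) A = A. *)
have [u v E _] := egcdnP p x_gt0; rewrite gcdnC (eqP cpx) in E.
have := eqn_mod_exp _ _ _ u Ax1; rewrite -expnM mulnC E exp1n expnD expn1.
rewrite -modnMml (mulnC v) expnM (eqn_mod_exp _ _ _ v Ap1) exp1n modnMml.
by rewrite mul1n.
Qed.

Hypothesis Wief : G ^ p.-1 = 1 %[mod p ^ 2].

Lemma expn_order_mod f t : G ^ (m * p ^ f * t) = 1 %[mod p ^ f.+2].
Proof.
rewrite -[RHS](f_equal (modn^~ _) (exp1n t)) expnM; apply: eqn_mod_exp.
elim: f => [|f IHf]; last first.
  by rewrite expnSr mulnA expnM -(exp1n p); apply: eqn_mod_exp_prime.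
(* Modulo p^2, 1 = G^(m p) = G^m (G^(p-1))^m = G^m. *)
have := eqn_mod_exp_prime p 0 _ _ p_pr Gm1; rewrite exp1n muln1 => <-.
rewrite -expnM -{2}(prednK (prime_gt0 p_pr)) mulnS expnD (mulnC m) expnM.
rewrite -modnMmr.
by rewrite (eqn_mod_exp _ _ _ m Wief) exp1n modnMmr muln1.
Qed.

Lemma expnD_order_mod f x t :
  G ^ (x + m * p ^ f * t) = G ^ x %[mod p ^ f.+2].
Proof. by rewrite expnD -modnMmr expn_order_mod modnMmr muln1. Qed.

Lemma sol_periodic f x t : sol f.+2 (x + m * p ^ f.+1 * t) = sol f.+2 x.
Proof.
rewrite /sol; congr (_ == _).
  apply: (eqn_mod_dvdm _ (p ^ f.+3)); first by rewrite dvdn_exp2l.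
  exact: expnD_order_mod.
apply: eqn_mod_exp_prime => //.
by rewrite mulnAC addnC modnMDl.
Qed.

Lemma sol_full_period f x : sol f.+2 (x + m * p ^ f.+2) = sol f.+2 x.
Proof. by rewrite expnSr mulnA sol_periodic. Qed.

(** If G^x = x modulo p, then x^p = G^(x p) = G^x (G^(p-1))^x = G^x modulo p^2. *)
Lemma sol_p2 x : sol 2 x = sol 1 x.
Proof.
apply/eqP/eqP => [|Gx]; first by apply: eqn_mod_dvdm; rewrite dvdn_exp2l.
rewrite expn1 fermat_little // in Gx.
rewrite -[RHS](eqn_mod_exp_prime _ 0 _ _ p_pr Gx) -expnM.
rewrite -{2}(prednK (prime_gt0 p_pr)) mulnS expnD (mulnC x) expnM -modnMmr.
by rewrite (eqn_mod_exp _ _ _ x Wief) exp1n modnMmr muln1.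
Qed.

Lemma sum_sol_lift f x : sol f.+2 x ->
  \sum_(t < p) sol f.+3 (x + m * p ^ f.+1 * t) = 1.
Proof.
move=> sx; have cpx := sol_coprime f.+2 x isT sx; move/eqP: sx => Gx.
have p_gt0 := prime_gt0 p_pr.
have cpK : coprime p (x ^ p.-1 * m) by rewrite coprimeMr coprimeXr.
rewrite -[RHS](linear_congr_uniq p (x ^ p %/ p ^ f.+2) (G ^ x %/ p ^ f.+2) _
  p_pr cpK).
apply: eq_bigr => t _; congr (nat_of_bool _).
rewrite /sol expnD_order_mod eq_sym.
have -> : (x + m * p ^ f.+1 * t) ^ p =
    x ^ p + p ^ f.+2 * (x ^ p.-1 * m * t) %[mod p ^ f.+3].
  (* Keeping the constant and linear terms takes 2 < p; the precision 2(f+1) + 1 is at least f +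
     3. *)
  apply: (eqn_mod_dvdm _ (p ^ (f.+1 * 2).+1)).
    by rewrite dvdn_exp2l //; lia.
  rewrite (expnD_mod_prime p f _ _ 2) ?prime_gt1 //.
  - rewrite big_ord_recr big_ord1 /= bin0 expn0 bin1 subn0 subn1.
    rewrite !mul1n muln1 expn1.
    rewrite [p ^ f.+2]expnS; move: (x ^ p.-1) (p ^ f.+1) => u v.
    by congr ((_ + _) %% _); ring.
  - by rewrite mulnAC dvdn_mull.
  - by have := prime_gt1 p_pr; lia.
(* The equal remainders modulo p^(f+2) cancel; the quotients remain to be compared modulo p. *)
rewrite {1}(divn_eq (x ^ p) (p ^ f.+2)) {1}(divn_eq (G ^ x) (p ^ f.+2)) Gx.
rewrite addnAC eqn_modDr mulnC -mulnDr (mulnC _ (p ^ _)).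
by rewrite [p ^ f.+3]expnSr -!muln_modr eqn_pmul2l ?expn_gt0 ?p_gt0.
Qed.

Lemma sum_sol f : \sum_(x < m * p ^ f.+1) sol f.+2 x = m.
Proof.
elim: f => [|f IHf].
  by rewrite -[RHS]sum_sol_modp; apply: eq_bigr => x _; rewrite sol_p2.
rewrite -[RHS]IHf expnSr mulnA; apply: count_lift => x.
  move=> t sx; rewrite -(sol_periodic _ _ t).
  by apply/eqP; move/eqP: sx; apply: eqn_mod_dvdm; rewrite dvdn_exp2l.
exact: sum_sol_lift.
Qed.

(** The range consists of p periods of length m p^(f+1), whence the factor p. *)
Lemma sum_sol_full_period f : \sum_(x < m * p ^ f.+2) sol f.+2 x = m * p.
Proof.
rewrite expnSr mulnA (sum_ord_mul (fun x => sol f.+2 x)) -[in RHS](sum_sol f).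
rewrite big_distrl; apply: eq_bigr => x _ /=.
under eq_bigr do rewrite sol_periodic.
by rewrite sum_nat_const card_ord mulnC.
Qed.

End Congruence.

(** * From Z_p to congruences between integers *)

Section Padic.
Variables (p : nat) (p_pr : prime p).
Implicit Types a b g : padic p_pr.
Local Open Scope ring_scope.

Lemma padic_natE k n : (k%:R : padic p_pr) n = k%:R.
Proof. by elim: k => // k IHk; rewrite !GRing.mulrS -IHk. Qed.

Lemma padic_expE a k n : (a ^+ k) n = a n ^+ k.
Proof. by elim: k => // k IHk; rewrite !GRing.exprS -IHk. Qed.

Lemma eqr_Zp_nat n i j :
  (1 < n)%N -> (i%:R == j%:R :> 'Z_n) = (i == j %[mod n])%N.
Proof. by move=> n_gt1; rewrite -val_eqE /= !val_Zp_nat. Qed.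

Lemma padic_approx_mod a n i :
  (a (n + i)%N : nat) = a n %[mod p ^ n.+1].
Proof.
elim: i => [|i IHi]; first by rewrite addn0.
rewrite -IHi addnS; apply: (eqn_mod_dvdm _ (p ^ (n + i).+1)%N).
  by rewrite dvdn_exp2l // ltnS leq_addr.
rewrite -(padic_coh a (n + i)) /zred val_Zp_nat ?ppow_gt1 //.
by rewrite modn_mod.
Qed.

Fact padic_divp_coh a e n :
  zred (p ^ n.+1) ((a (n.+1 + e)%N %/ p ^ e)%:R : 'Z_(p ^ n.+2)) =
  (a (n + e)%N %/ p ^ e)%:R.
Proof.
rewrite zred_nat ?ppow_gt1 ?ppow_dvd //; apply/eqP.
rewrite eqr_Zp_nat ?ppow_gt1 // !modn_divl -expnD addSn; apply/eqP.
by congr (_ %/ _)%N; have := padic_approx_mod a (n + e) 1; rewrite addn1.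
Qed.
(* The quotient of a by p^e, with digits shifted; exact only if p^e divides a. *)
Definition padic_divp a e : padic p_pr := Padic p_pr (padic_divp_coh a e).

(** The component of index e lives modulo p^(e+1). Conversely, shifting the digits of a - b by e + 1
    places gives the cofactor. *)
Lemma padic_eqmodP e a b : padic_eqmod e.+1 a b <-> a e = b e.
Proof.
split=> [[c] /(congr1 (fun u : padic p_pr => u e)) | eq_ab].
  rewrite /= -GRing.natrX padic_natE => E.
  apply: GRing.subr0_eq; rewrite [LHS]E.
  have -> : (p ^ e.+1)%:R = 0 :> 'Z_(p ^ e.+1).
    by apply/eqP; rewrite (eqr_Zp_nat _ _ 0) ?ppow_gt1 // modnn mod0n.
  by rewrite GRing.mul0r.
have d0 : (a - b) e = 0 by rewrite /= eq_ab GRing.subrr.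
rewrite /padic_eqmod; move: (a - b) d0 => d d0; exists (padic_divp d e.+1).
apply: padicP => n.
rewrite -[LHS]natr_Zp /= -GRing.natrX padic_natE -GRing.natrM.
have p_d : (p ^ e.+1 %| d (n + e.+1))%N.
  have := padic_approx_mod d e n.+1; rewrite d0 /= mod0n addnS -addSnnS.
  by rewrite addnC /dvdn => ->.
apply/eqP; rewrite mulnC divnK // eqr_Zp_nat ?ppow_gt1 //.
by rewrite eq_sym padic_approx_mod.
Qed.

(** The free index [i] lets one integer approximating g serve modulo p, p^2 and the full modulus at
    once. *)
Lemma padic_eqmod_nat g x y e i :
  padic_eqmod e.+1 (g ^+ x) y%:R <->
  (g (e + i)%N ^ x = y %[mod p ^ e.+1])%N.
Proof.
rewrite padic_eqmodP padic_expE padic_natE -[g e]natr_Zp -GRing.natrX.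
rewrite (rwP eqP) eqr_Zp_nat ?ppow_gt1 // -(rwP eqP).
by rewrite (eqn_mod_exp _ _ _ x (padic_approx_mod g e i)).
Qed.

Lemma nb_solutionsE g k e B :
  nb_solutions g k e.+1 B =
  count (fun x => g e ^ x == x ^ k %[mod p ^ e.+1])%N (iota 1 B).
Proof.
apply: eq_count => x; have := padic_eqmod_nat g x (x ^ k)%N e 0.
by rewrite addn0 GRing.natrX => -[? ?]; apply/asboolP/eqP.
Qed.

Section Order.
Variables (g : padic p_pr) (g_unit : g \is a GRing.unit).

Lemma order_modp_dvd j :
  (order_modp g_unit %| j)%N <-> padic_eqmod 1 (g ^+ j) 1%:R.
Proof.
rewrite padic_eqmodP padic_expE /order_modp order_dvdn.
rewrite -val_eqE FinRing.val_unitX.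
by split=> [/eqP|E]; [|apply/eqP].
Qed.

Lemma coprime_padic_unit n : coprime p (g n).
Proof.
have := padic_unit_approx n g_unit.
by rewrite -{1}[g n]natr_Zp unitZpE ?ppow_gt1 // coprime_pexpl.
Qed.

Lemma expn_order_modp n : (g n ^ order_modp g_unit = 1 %[mod p])%N.
Proof. exact/(padic_eqmod_nat g _ 1 0 n)/order_modp_dvd. Qed.

Lemma order_modp_dvd_pred : (order_modp g_unit %| p.-1)%N.
Proof.
apply/order_modp_dvd/(padic_eqmod_nat g _ 1 0 0).
exact/expn_pred_mod1/coprime_padic_unit.
Qed.

End Order.
End Padic.

(** * The number of solutions for a p-adic base *)

Theorem theorem10 (p : nat) (p_pr : prime p) (p_neq2 : p <> 2)
    (g : padic p_pr) (g_unit : (g \is a GRing.unit)%R) :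
  let k := p in
  let n := 1 in
  let m := order_modp g_unit in
  let d := gcdn k p.-1 %/ gcdn k (p.-1 %/ m) in
  let N := (m * gcdn k p.-1) %/
           \prod_(q <- primes d) q ^ ceil_div (logn q d) n in
  nb_solutions g p 1 (m * p) = N /\
  forall e : nat, 1 < e ->
    (Wieferich_base g -> nb_solutions g p e (m * p ^ e) = N * p) /\
    (~ Wieferich_base g -> nb_solutions g p e (m * p ^ e) = 0).
Proof.
move=> k n m d N.
have p_gt1 := prime_gt1 p_pr.
have m_dvd : m %| p.-1 := order_modp_dvd_pred _ _ _ g_unit.
have cp j : j %| p.-1 -> coprime p j.
  move=> jp; rewrite prime_coprime // gtnNdvd ?(dvdn_gt0 _ jp) //; first by lia.
  by have := dvdn_leq _ jp; lia.
have N_m : N = m.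
  have cq : coprime p (p.-1 %/ m) by rewrite cp // dvdn_div.
  (* Both gcds are 1, so d = 1 and the product over its primes is empty. *)
  rewrite /N /d /k (eqP (cp _ (dvdnn _))) (eqP cq) big_nil.
  by rewrite muln1 divn1.
have cpm : coprime p m := cp m m_dvd.
have cpG := coprime_padic_unit _ _ _ g_unit.
have Gm1 := expn_order_modp _ _ _ g_unit.
rewrite N_m; split.
  rewrite nb_solutionsE count_iota_periodic ; first exact: sum_sol_modp.
  exact: sol_modp_periodic.
case=> [|[|e]] // _; rewrite nb_solutionsE.
have WP : Wieferich_base g <-> g e.+1 ^ p.-1 = 1 %[mod p ^ 2].
  exact: (padic_eqmod_nat _ _ g _ 1 1 e).
split=> [/WP W | nW].
  rewrite count_iota_periodic; first exact: sum_sol_full_period.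
  by move=> x; apply: sol_full_period.
rewrite -[RHS](count_pred0 (iota 1 (m * p ^ e.+2))); apply: eq_count => x.
apply/negP => /eqP sx; apply/nW/WP.
(* A solution modulo p^(e+2) is one modulo p^2, which already forces the base to be Wieferich. *)
apply: (sol_p2_Wieferich _ p_pr _ (cpG e.+1) x).
by apply/eqP; apply: eqn_mod_dvdm sx; rewrite dvdn_exp2l.
Qed.
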